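(* Let $n\ge1$ be an integer, let $\mathcal{C}\ell_{0,n}$ be the real Clifford algebra with generators $e_1,\dots,e_n$ satisfying $e_ie_j+e_je_i=-2\delta_{ij}$, and let $(c_k(n))_{k\ge0}$ be the generalized Vietoris number sequence. Then for every integer $k\ge0$, $$c_k(n)=(-1)^k\left[\sum_{|\nu|=k}\binom{k}{\nu}\left(e_1^{\nu_1}\times e_2^{\nu_2}\times\cdots\times e_n^{\nu_n}\right)^2\right]^{-1},$$ where the sum runs over all multi-indices $\nu=(\nu_1,\dots,\nu_n)$ of non-negative integers with $|\nu|=\nu_1+\cdots+\nu_n=k$, and $\times$ denotes the symmetric (permutational) product in $\mathcal{C}\ell_{0,n}$.
   Context: $(a)_s$ denotes the Pochhammer symbol (rising factorial): $(a)_0=1$ and $(a)_s=a(a+1)\cdots(a+s-1)$ for $s\ge1$. For each integer $n\ge1$, the generalized Vietoris number sequence $(c_k(n))_{k\ge0}$ is the sequence of real numbers given by $c_0(n)=1$ and $$c_{2s}(n)=c_{2s-1}(n)=\frac{\left(\tfrac12\right)_s}{\left(\tfrac n2\right)_s},\qquad s\ge1.$$ (Equivalently, $c_k(n)=\sum_{s=0}^{k}(-1)^s\binom{k}{s}\frac{\left(\frac{n+1}{2}\right)_{k-s}\left(\frac{n-1}{2}\right)_s}{(n)_k}$ for $k\ge0$.) $\mathcal{C}\ell_{0,n}$ is the $2^n$-dimensional associative unital real algebra generated by an orthonormal basis $e_1,\dots,e_n$ of $\mathbb{R}^n$ subject to $e_ie_j+e_je_i=-2\delta_{ij}$ for $i,j=1,\dots,n$;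 its basis consists of the products $e_{h_1}\cdots e_{h_r}$ with $1\le h_1<\cdots<h_r\le n$, the empty product being $1$. Real numbers are identified with real multiples of $1$ in $\mathcal{C}\ell_{0,n}$, and $[\,\cdot\,]^{-1}$ denotes the inverse in this algebra. Symmetric product: for elements $a_1,\dots,a_k$ of a (possibly non-commutative) ring, $$a_1\times a_2\times\cdots\times a_k=\frac{1}{k!}\sum_{\pi}a_{\pi(1)}a_{\pi(2)}\cdots a_{\pi(k)},$$ the sum running over all $k!$ permutations $\pi$ of $\{1,\dots,k\}$. For a multi-index $\nu=(\nu_1,\dots,\nu_n)$ with $|\nu|=k$, the notation $e_1^{\nu_1}\times\cdots\times e_n^{\nu_n}$ means the symmetric product of the $k$ factors in which $e_j$ occurs exactly $\nu_j$ times ($j=1,\dots,n$); for $k=0$ it equals $1$. The power $(\cdot)^2$ outside the parentheses is the ordinary square in $\mathcal{C}\ell_{0,n}$. The multinomial coefficient is $\binom{k}{\nu}=\frac{k!}{\nu_1!\cdots\nu_n!}$. *)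

(* Defs.v *)
From HB Require Import structures.
From mathcomp Require Import all_boot all_order all_algebra all_fingroup all_field.
From mathcomp Require Import reals.

Set Implicit Arguments.
Unset Strict Implicit.
Unset Printing Implicit Defensive.

Import GRing.Theory.
Local Open Scope ring_scope.

Section SymmetricDifference.
Variable T : finType.
Implicit Types A B C : {set T}.

Definition symdiff A B : {set T} := (A :\: B) :|: (B :\: A).

Lemma in_symdiff A B x : (x \in symdiff A B) = (x \in A) (+) (x \in B).
Proof. by rewrite !inE; case: (x \in A); case: (x \in B). Qed.

Lemma symdiffA : associative symdiff.
Proof. by move=> A B C; apply/setP=> x; rewrite !in_symdiff addbA. Qed.

Lemma symdiff0 A : symdiff A set0 = A.
Proof. by apply/setP=> x; rewrite in_symdiff inE addbF. Qed.

Lemma symdiff0l A : symdiff set0 A = A.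
Proof. by apply/setP=> x; rewrite in_symdiff inE. Qed.

Lemma symdiffKl A : involutive (symdiff A).
Proof. by move=> B; apply/setP=> x; rewrite !in_symdiff addKb. Qed.

Lemma symdiff_eq A B C : (symdiff A B == C) = (B == symdiff A C).
Proof. exact: (can2_eq (symdiffKl A) (symdiffKl A)). Qed.

Lemma prod_symdiff (R : comPzRingType) (F : T -> R) A B :
  (forall i, F i * F i = 1) ->
  \prod_(i in symdiff A B) F i = (\prod_(i in A) F i) * \prod_(i in B) F i.
Proof.
move=> F2; rewrite big_mkcond [X in _ = X * _]big_mkcond.
rewrite [X in _ = _ * X]big_mkcond -big_split; apply: eq_bigr => i _.
by rewrite in_symdiff; case: (i \in A); case: (i \in B); rewrite /= ?mulr1 ?mul1r.
Qed.

End SymmetricDifference.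

(* The Clifford algebra Cl_{0,n} over the field R. An element is the family of
   its 2^n coordinates on the products e_A = e_{h_1} ... e_{h_r}, where
   A = {h_1 < ... < h_r}. The alias hides the pointwise product of {ffun _}. *)
Definition clifford (R : fieldType) (n : nat) := {ffun {set 'I_n} -> R^o}.

Section Clifford.
Variables (R : fieldType) (n : nat).
Implicit Types (A B C : {set 'I_n}) (x y z : clifford R n).

HB.instance Definition _ :=
  Vector.copy (clifford R n) {ffun {set 'I_n} -> R^o}.

(* e_A e_B = cl_sign A B e_(A symdiff B): there is one factor -1 for each pair
   j < i with i in A and j in B (from e_i e_j = - e_j e_i), and one for each i
   in both A and B (from e_i ^ 2 = -1). *)
Definition cl_sign A B : R := \prod_(i in A) \prod_(j in B | (j <= i)%N) -1.

Definition cl_mul x y : clifford R n :=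
  [ffun C => \sum_A \sum_(B | symdiff A B == C) cl_sign A B * (x A * y B)].

Definition cl_basis A : clifford R n := [ffun B => (B == A)%:R].

Definition cl_gen (i : 'I_n) : clifford R n := cl_basis [set i].

Lemma cl_signDl A B C :
  cl_sign (symdiff A B) C = cl_sign A C * cl_sign B C.
Proof.
apply: prod_symdiff => i; rewrite -big_split /=.
by apply: big1 => j _; rewrite mulrNN mulr1.
Qed.

Lemma cl_signDr A B C :
  cl_sign A (symdiff B C) = cl_sign A B * cl_sign A C.
Proof.
rewrite /cl_sign -big_split; apply: eq_bigr => i _ /=.
rewrite !big_mkcondr; apply: prod_symdiff => j.
by case: ifP; rewrite ?mulrNN mulr1.
Qed.

Lemma cl_sign0 A : cl_sign A set0 = 1.
Proof. by apply: big1 => i _; rewrite big_pred0 // => j; rewrite inE. Qed.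

Lemma cl_sign0l A : cl_sign set0 A = 1.
Proof. by rewrite /cl_sign big_set0. Qed.

Lemma cl_mulE x y C :
  cl_mul x y C
  = \sum_A cl_sign A (symdiff A C) * (x A * y (symdiff A C)).
Proof.
rewrite ffunE; apply: eq_bigr => A _.
by rewrite (big_pred1 (symdiff A C)) // => B; rewrite /= symdiff_eq.
Qed.

Fact cl_mulA : associative cl_mul.
Proof.
move=> x y z; apply/ffunP=> D; rewrite !cl_mulE.
transitivity (\sum_A \sum_B cl_sign (symdiff A B) (symdiff (symdiff A B) D) *
   (cl_sign A B * (x A * y B) * z (symdiff (symdiff A B) D))); last first.
  rewrite [RHS](eq_bigr (fun E => \sum_A
      cl_sign E (symdiff E D) * (cl_sign A (symdiff A E) *
      (x A * y (symdiff A E)) * z (symdiff E D)))); last first.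
    by move=> E _; rewrite cl_mulE mulr_suml mulr_sumr.
  rewrite [RHS]exchange_big; apply: eq_bigr => A _ /=.
  rewrite [RHS](reindex_inj (inv_inj (symdiffKl A))) /=.
  by apply: eq_bigr => B _; rewrite symdiffKl.
apply: eq_bigr => A _; rewrite cl_mulE !mulr_sumr; apply: eq_bigr => B _.
have symC : symdiff A B = symdiff B A by rewrite /symdiff setUC.
rewrite (symdiffA B A D) -symC; set F := symdiff (symdiff A B) D.
have -> : symdiff A D = symdiff B F.
  by rewrite /F symC -symdiffA symdiffKl.
rewrite cl_signDl cl_signDr -!mulrA mulrCA; congr (_ * _).
by rewrite [x A * (cl_sign _ _ * _)]mulrCA [LHS]mulrCA.
Qed.

Fact cl_mul1x : left_id (cl_basis set0) cl_mul.
Proof.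
move=> x; apply/ffunP=> C; rewrite cl_mulE (bigD1 set0) //= big1 => [|A].
  by rewrite addr0 symdiff0l cl_sign0l ffunE eqxx !mul1r.
by rewrite ffunE => /negbTE->; rewrite mul0r mulr0.
Qed.

Fact cl_mulx1 : right_id (cl_basis set0) cl_mul.
Proof.
move=> x; apply/ffunP=> C; rewrite cl_mulE (bigD1 C) //= big1 => [|A].
  have -> : symdiff C C = set0 by apply/setP=> i; rewrite in_symdiff addbb inE.
  by rewrite addr0 cl_sign0 ffunE eqxx mulr1 mul1r.
rewrite eq_sym ffunE symdiff_eq symdiff0 => /negbTE->.
by rewrite !mulr0.
Qed.

Fact cl_mulDl : left_distributive cl_mul +%R.
Proof.
move=> x y z; apply/ffunP=> C; rewrite [RHS]ffunE !cl_mulE -big_split.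
by apply: eq_bigr => A _; rewrite ffunE mulrDl mulrDr.
Qed.

Fact cl_mulDr : right_distributive cl_mul +%R.
Proof.
move=> x y z; apply/ffunP=> C; rewrite [RHS]ffunE !cl_mulE -big_split.
by apply: eq_bigr => A _; rewrite ffunE !mulrDr.
Qed.

Fact cl_oner_neq0 : cl_basis set0 != 0.
Proof.
by apply/eqP=> /ffunP/(_ set0); rewrite !ffunE eqxx; apply/eqP/oner_neq0.
Qed.

HB.instance Definition _ := GRing.Zmodule_isNzRing.Build (clifford R n)
  cl_mulA cl_mul1x cl_mulx1 cl_mulDl cl_mulDr cl_oner_neq0.

Lemma cl_mulrE x y C :
  (x * y) C = \sum_A cl_sign A (symdiff A C) * (x A * y (symdiff A C)).
Proof. exact: cl_mulE. Qed.

Lemma cl_scaleE (a : R) x C : (a *: x) C = a * x C.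
Proof. by rewrite ffunE. Qed.

Fact cl_scalerAl (a : R) x y : a *: (x * y) = (a *: x) * y.
Proof.
apply/ffunP=> C; rewrite cl_scaleE !cl_mulrE mulr_sumr; apply: eq_bigr => A _.
by rewrite cl_scaleE mulrCA -mulrA.
Qed.

HB.instance Definition _ :=
  GRing.Lmodule_isLalgebra.Build R (clifford R n) cl_scalerAl.

Fact cl_scalerAr (a : R) x y : a *: (x * y) = x * (a *: y).
Proof.
apply/ffunP=> C; rewrite cl_scaleE !cl_mulrE mulr_sumr; apply: eq_bigr => A _.
by rewrite cl_scaleE mulrCA [a * (_ * _)]mulrCA.
Qed.

HB.instance Definition _ :=
  GRing.Lalgebra_isAlgebra.Build R (clifford R n) cl_scalerAr.

HB.instance Definition _ := Algebra_isFalgebra.Build R (clifford R n).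

Lemma cl_dim : dim (clifford R n) = (2 ^ n)%N.
Proof. by rewrite /dim /= muln1 -cardsT -powersetT card_powerset cardsT card_ord. Qed.

Lemma cl_basisM A B :
  cl_basis A * cl_basis B = cl_sign A B *: cl_basis (symdiff A B).
Proof.
apply/ffunP=> C; rewrite cl_scaleE cl_mulrE (bigD1 A) //= big1 => [|A' /negbTE nA].
  rewrite !ffunE eqxx mul1r addr0.
  rewrite eq_sym -symdiff_eq eq_sym; case: eqP => [->|_].
    by rewrite symdiffKl.
  by rewrite !mulr0.
by rewrite ffunE nA mul0r mulr0.
Qed.

Lemma cl_gen_anticomm (i j : 'I_n) :
  cl_gen i * cl_gen j + cl_gen j * cl_gen i = (- 2 * (i == j)%:R)%:A.
Proof.
have sgn (k l : 'I_n) : cl_sign [set k] [set l] = if (l <= k)%N then -1 else 1.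
  by rewrite /cl_sign big_set1 big_mkcondr big_set1.
rewrite !cl_basisM /symdiff setUC -scalerDl !sgn.
case: (ltngtP i j) => [lt_ij|lt_ji|/val_inj->].
- by rewrite subrr -val_eqE (ltn_eqF lt_ij) mulr0 !scale0r.
- by rewrite addrC subrr -val_eqE (gtn_eqF lt_ji) mulr0 !scale0r.
by rewrite eqxx mulr1 setDv setU0 -opprD.
Qed.

Lemma cl_basisE A : cl_basis A = \prod_(i in A) cl_gen i.
Proof.
have sA : sorted (fun i j : 'I_n => (i < j)%N) (enum A).
  have -> : enum A = [seq i <- enum 'I_n | i \in A] by rewrite enumT.
  apply: sorted_filter => [? ? ?|]; first exact: ltn_trans.
  by have := iota_ltn_sorted 0 n; rewrite -val_enum_ord sorted_map.
rewrite -big_filter [index_enum _]unlock -/(enum A) -[in LHS](set_enum A).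
elim: (enum A) sA => [_|i s IHs].
  by rewrite big_nil; congr cl_basis; apply/setP=> i; rewrite !inE.
rewrite /= path_sortedE; last by move=> ? ? ?; apply: ltn_trans.
move=> /andP[/allP lt_is sS].
rewrite big_cons -IHs // cl_basisM {1}/cl_sign big_set1 big1 ?scale1r; last first.
  by move=> j; rewrite inE => /andP[/lt_is lt_ij]; rewrite leqNgt lt_ij.
congr cl_basis; apply/setP=> j; rewrite in_symdiff !inE.
by case: eqP => [->|//]; case: (boolP (i \in s)) => // /lt_is; rewrite ltnn.
Qed.

Lemma cl_decomp x : x = \sum_A x A *: \prod_(i in A) cl_gen i.
Proof.
under eq_bigr do rewrite -cl_basisE.
apply/ffunP=> B; rewrite sum_ffunE (bigD1 B) //= big1 => [|A /negbTE nAB].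
  by rewrite cl_scaleE ffunE eqxx mulr1 addr0.
by rewrite cl_scaleE ffunE eq_sym nAB mulr0.
Qed.

End Clifford.

Definition symmetric_product (R : fieldType) (V : algType R) (s : seq V) : V :=
  (size s)`!%:R^-1 *: \sum_(p : 'S_(size s)) \prod_(i < size s) s`_(p i).

Definition multinomial (n : nat) (nu : 'I_n -> nat) : nat :=
  ((\sum_j nu j)`! %/ \prod_j (nu j)`!)%N.

Definition symmetric_power_product (R : fieldType) (n : nat)
    (nu : 'I_n -> nat) : clifford R n :=
  symmetric_product (flatten [seq nseq (nu j) (cl_gen R j) | j <- enum 'I_n]).

Definition pochhammer (R : fieldType) (a : R) (s : nat) : R :=
  \prod_(i < s) (a + i%:R).

(* uphalf (2 * s) = s, and uphalf (2 * s - 1) = s when s > 0. *)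
Definition vietoris (R : fieldType) (n k : nat) : R :=
  pochhammer (1 / 2) (uphalf k) / pochhammer (n%:R / 2) (uphalf k).

(* Main.v *)
(* Let W(c) be the sum of the products of a word containing c_j letters e_j over
   all k! orderings of its letters. Choosing the first letter gives
   W(c) = sum_j c_j e_j W(c - delta_j), and since the generators anticommute
   this recursion has a closed solution: W(c) vanishes as soon as two of the
   c_j are odd, and otherwise it is, up to sign,
   (k/2)! prod_j (c_j! / (c_j/2)!) times 1 or the single e_i with c_i odd
   (all halves rounded down). Squaring, S is (-1)^k times a scalar sum of
   prod_j c_j! / (c_j/2)!^2, that is, a coefficient of G^n + n D G^(n-1), where
   G = sum_m C(2m,m) X^(2m) = (1 - 4 X^2)^(-1/2) and
   D = sum_m (2m+1) C(2m,m) X^(2m+1) = X (X G)'. The differential equation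
   (1 - 4 X^2) G' = 4 X G yields a two-term recursion for the coefficients of
   G^n, solved by 4^s (n/2)_s / s!. *)
Require Import Defs.
From mathcomp Require Import all_boot all_order all_algebra all_fingroup all_field.
From mathcomp Require Import reals zify ring.
Set Implicit Arguments.
Unset Strict Implicit.
Unset Printing Implicit Defensive.
Import Order.TTheory GRing.Theory Num.Theory.
Local Open Scope ring_scope.

(** * Permutations split by their first value, and the factorial quotients c!/(c/2)! *)

Lemma sum_perm_first (V : pzRingType) m (f : 'I_m.+1 -> V) :
  \sum_(p : 'S_m.+1) \prod_i f (p i)
  = \sum_i f i * \sum_(q : 'S_m) \prod_l f (lift i (q l)).
Proof.
rewrite (partition_big (fun p : 'S_m.+1 => p ord0) xpredT) //=.
apply: eq_bigr => i _; rewrite (reindex (lift_perm ord0 i)) /=; last first.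
  (* [inv p] deletes [ord0] and its image from [p], which inverts [lift_perm]. The default [l] is
     never reached, since [p] is injective. *)
  pose inv (p : 'S_m.+1) (l : 'I_m) := odflt l (unlift (p ord0) (p (lift ord0 l))).
  have invK (p : 'S_m.+1) l : lift (p ord0) (inv p l) = p (lift ord0 l).
    rewrite /inv; case: unliftP => [l' ->|] //=.
    by move/perm_inj/esym/eqP; rewrite (negPf (neq_lift _ _)).
  have inv_inj p : injective (inv p).
    move=> l l' /(congr1 (lift (p ord0))); rewrite !invK.
    by move/perm_inj/lift_inj.
  exists (fun p => perm (@inv_inj p)) => [q _|p].
    by apply/permP=> l; rewrite permE /inv lift_perm_lift lift_perm_id liftK.
  rewrite inE => /eqP p0; apply/permP=> l.
  case: (unliftP ord0 l) => [l'|] ->; last by rewrite lift_perm_id.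
  by rewrite lift_perm_lift permE -p0 invK.
rewrite mulr_sumr; apply: eq_big => [q|q _]; first by rewrite lift_perm_id eqxx.
rewrite big_ord_recl lift_perm_id; congr (_ * _).
by apply: eq_bigr => l _; rewrite lift_perm_lift.
Qed.

Lemma ffact_uphalf_fact c : (c ^_ (uphalf c) * c./2`! = c`!)%N.
Proof.
have -> : c./2 = (c - uphalf c)%N by lia.
by rewrite ffact_fact //; lia.
Qed.

(** For odd c the half of c-1 is still c/2. For positive even c it is one less, hence the extra
    factor [c./2] in the next lemma. *)
Lemma ffact_uphalf_odd c : odd c -> (c * c.-1 ^_ (uphalf c.-1) = c ^_ (uphalf c))%N.
Proof.
move=> c_odd; apply/eqP; rewrite -(eqn_pmul2r (fact_gt0 c./2)) -mulnA.
have {1}-> : c./2 = c.-1./2 by lia.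
by rewrite !ffact_uphalf_fact; case: c c_odd.
Qed.

Lemma ffact_uphalf_even c :
  ~~ odd c -> (c * c.-1 ^_ (uphalf c.-1) = c./2 * c ^_ (uphalf c))%N.
Proof.
case: c => // c c_even; apply/eqP.
rewrite -(eqn_pmul2r (fact_gt0 c./2)) -mulnA ffact_uphalf_fact -factS.
have -> : c.+1./2 = (c./2).+1 by move: c_even => /=; lia.
rewrite mulnAC -factS -ffact_uphalf_fact mulnC.
by have -> : c.+1./2 = (c./2).+1 by move: c_even => /=; lia.
Qed.

(** * Sums over the orderings of a word *)

Section SymmetricProducts.
Variables (R : fieldType) (n : nat).
Implicit Types (c : 'I_n -> nat).

Definition odd_support c : {set 'I_n} := [set j | odd (c j)].

(** When at most one c_j is odd, the letters form k/2 pairs of equal letters, each contributing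
    e_j^2 = -1. The factorials are the number of arrangements of these pairs, (k/2)!/prod_j
    (c_j/2)!, times prod_j c_j!. *)
Definition words_coef c : R :=
  (-1) ^+ (\sum_j c j)./2 * (\sum_j c j)./2`!%:R
    * \prod_j (c j ^_ (uphalf (c j)))%:R.

(* The closed form of the sum of all orderings of a word with [c j] letters
   [cl_gen R j]; note that [c ^_ (uphalf c)] is [c! / (c/2)!]. *)
Definition words_sum c : clifford R n :=
  (if (#|odd_support c| <= 1)%N then words_coef c else 0)
    *: cl_basis R (odd_support c).

(** The subtraction truncates at c_i = 0, where the multiplicity [c i] in the recursion kills the
    term. *)
Definition decr c (i : 'I_n) : 'I_n -> nat := fun j => (c j - (j == i))%N.

Lemma eq_words_sum c d : c =1 d -> words_sum c = words_sum d.
Proof.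
move=> cd; rewrite /words_sum /words_coef.
have -> : odd_support c = odd_support d by apply/setP=> j; rewrite !inE cd.
have -> : (\sum_j c j = \sum_j d j)%N by apply: eq_bigr.
by rewrite [\prod_j _](eq_bigr (fun j => (d j ^_ (uphalf (d j)))%:R)) // => j _; rewrite cd.
Qed.

Lemma sum_decr c i : (0 < c i)%N -> (\sum_j decr c i j = (\sum_j c j).-1)%N.
Proof.
move=> ci; rewrite (bigD1 i) //= (bigD1 (P := xpredT) (F := c) i) //=.
rewrite /decr eqxx (eq_bigr c); first by move: ci; case: (c i) => //= m; rewrite subn1.
by move=> j /negbTE->; rewrite subn0.
Qed.

Lemma odd_support_decr c i :
  (0 < c i)%N -> odd_support (decr c i) = symdiff [set i] (odd_support c).
Proof.
move=> ci; apply/setP=> j; rewrite in_symdiff !inE /decr.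
by case: eqP => [->|_]; rewrite ?subn0 // oddB // addbC.
Qed.

Lemma words_coef_decr c i : (0 < c i)%N ->
  (c i)%:R * words_coef (decr c i)
  = (-1) ^+ (\sum_j c j).-1./2 * (\sum_j c j).-1./2`!%:R
    * ((if odd (c i) then 1 else (c i)./2)%N%:R * \prod_j (c j ^_ (uphalf (c j)))%:R).
Proof.
move=> ci; rewrite /words_coef sum_decr // mulrCA; congr (_ * _).
rewrite (bigD1 i) //= [in RHS](bigD1 i) //= !mulrA -!natrM.
rewrite /decr eqxx subn1; congr (_%:R * _).
  case: ifP => [/ffact_uphalf_odd->|/negbT/ffact_uphalf_even-> //].
  by rewrite mul1n.
by apply: eq_bigr => j /negbTE->; rewrite subn0.
Qed.

Lemma card_symdiff1 i (A : {set 'I_n}) :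
  #|symdiff [set i] A| = if i \in A then #|A|.-1 else #|A|.+1.
Proof.
case: ifP => iA.
  rewrite (cardsD1 i A) iA /= ; congr #|pred_of_set _|; apply/setP=> j.
  by rewrite in_symdiff !inE; case: eqP => [->|]; rewrite ?iA.
transitivity #|i |: A|; last by rewrite cardsU1 iA.
congr #|pred_of_set _|; apply/setP=> j.
by rewrite in_symdiff !inE; case: eqP => [->|]; rewrite ?iA.
Qed.

Lemma cl_sign11 (i j : 'I_n) :
  cl_sign R [set i] [set j] = if (j <= i)%N then -1 else 1.
Proof. by rewrite /cl_sign big_set1 big_mkcondr big_set1. Qed.

(** Puts every term of the recursion on the same basis element, so that only scalars remain to be
    compared; the minus sign is e_i^2 = -1. *)
Lemma cl_gen_symdiffM (i : 'I_n) (A : {set 'I_n}) :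
  cl_gen R i * cl_basis R (symdiff [set i] A)
  = (- cl_sign R [set i] A) *: cl_basis R A.
Proof. by rewrite cl_basisM symdiffKl cl_signDr cl_sign11 leqnn mulN1r. Qed.

Lemma odd_sum c : odd (\sum_j c j) = odd #|odd_support c|.
Proof.
rewrite -sum1_card [in RHS]big_mkcond (big_morph odd oddD (erefl : odd 0 = false)).
rewrite (big_morph odd oddD (erefl : odd 0 = false)).
by apply: eq_bigr => j _; rewrite inE; case: (odd (c j)).
Qed.

(** Let O be the set of odd letters. If |O| > 2, all terms vanish. If |O| = 2, the terms of its two
    letters cancel because these anticommute. If |O| = 1, only the odd letter contributes. If O is
    empty, letter i has weight c_i/2. *)
Lemma words_sum_rec c : (0 < \sum_j c j)%N ->
  \sum_i (cl_gen R i * words_sum (decr c i)) *+ c i = words_sum c.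
Proof.
move=> c_gt0; pose O := odd_support c.
pose F i := - cl_sign R [set i] O *
  (if (#|symdiff [set i] O| <= 1)%N then (c i)%:R * words_coef (decr c i) else 0).
have Fdec i : (cl_gen R i * words_sum (decr c i)) *+ c i = F i *: cl_basis R O.
  have [ci|ci] := posnP (c i).
    by rewrite /F ci mulr0n mul0r if_same mulr0 scale0r.
  rewrite /words_sum odd_support_decr // -scalerAr cl_gen_symdiffM scalerA.
  rewrite -scaler_nat scalerA /F; congr (_ *: _).
  by case: ifP; rewrite ?mul0r ?mulr0 // [_ * - _]mulrC mulrCA.
rewrite (eq_bigr _ (fun i _ => Fdec i)) -scaler_suml; congr (_ *: _).
(* Deleting a letter outside a nonempty O leaves at least two odd letters. *)
have Fnot i : (0 < #|O|)%N -> i \notin O -> F i = 0.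
  move=> O0 /negbTE iO; rewrite /F card_symdiff1 iO ltnS leqNgt O0 mulr0 //.
have odd_k := odd_sum c; rewrite -/O in odd_k *.
have [O_le2|O_gt2] := leqP #|O| 2; last first.
  rewrite leqNgt (ltn_trans _ O_gt2) //= big1 // => i _.
  suff /negbTE le1 : ~~ (#|symdiff [set i] O| <= 1)%N by rewrite /F le1 mulr0.
  by rewrite card_symdiff1; case: ifP; lia.
have Fodd i : i \in O -> F i = - cl_sign R [set i] O *
    ((-1) ^+ (\sum_j c j).-1./2 * (\sum_j c j).-1./2`!%:R
      * \prod_j (c j ^_ (uphalf (c j)))%:R).
  move=> iO; have ci_odd : odd (c i) by move: iO; rewrite inE.
  rewrite /F card_symdiff1 iO -subn1 leq_subLR O_le2 words_coef_decr ?odd_gt0 //.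
  by rewrite ci_odd mul1r.
case: (posnP #|O|) => [O0|O_gt0]; last first.
  rewrite (bigID (mem O)) /= [X in _ + X]big1 ?addr0; last by move=> i; apply: Fnot.
  rewrite (eq_bigr _ Fodd) -mulr_suml.
  have [O1|O_gt1] := leqP #|O| 1.
    have /cards1P[i Oi] : #|O| == 1 by rewrite eqn_leq O1.
    rewrite Oi big_set1 cl_sign11 leqnn opprK mul1r /words_coef.
    suff -> : (\sum_j c j).-1./2 = (\sum_j c j)./2 by [].
    by move: odd_k; rewrite Oi cards1; lia.
  have /cards2P[i [l [il Oil]]] : #|O| == 2 by rewrite eqn_leq O_le2.
  have OE : O = symdiff [set i] [set l].
    rewrite Oil; apply/setP=> j; rewrite in_symdiff !inE.
    by case: eqP => [->|]; rewrite ?(negbTE il).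
  rewrite Oil big_setU1 ?inE //= big_set1 -Oil OE !cl_signDr !cl_sign11.
  rewrite !leqnn.
  case: ltngtP il => [||/val_inj->]; rewrite ?eqxx // => _ _;
    by rewrite !(mulN1r, mulr1, mul1r, opprK) (addNr, subrr) mul0r.
have c_even i : ~~ odd (c i) by move/eqP: O0; rewrite cards_eq0 => /eqP/setP/(_ i); rewrite !inE => ->.
have Oset0 : O = set0 by apply/eqP; rewrite -cards_eq0 O0.
rewrite O0 /= /words_coef.
have k_even : ~~ odd (\sum_j c j) by rewrite odd_k O0.
have half_k : ((\sum_j c j)./2 = (\sum_j c j).-1./2.+1)%N by lia.
rewrite half_k; set m := (_.-1)./2.
have Feven i : F i = (-1) ^+ m.+1 * m`!%:R * (\prod_j (c j ^_ (uphalf (c j)))%:R) * (c i)./2%:R.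
  rewrite /F card_symdiff1 Oset0 inE cards0 cl_sign0 /=.
  have [ci|ci] := posnP (c i); first by rewrite ci mul0r !mulr0.
  by rewrite words_coef_decr // (negbTE (c_even i)) -/m exprS; ring.
rewrite (eq_bigr _ (fun i _ => Feven i)) -mulr_sumr -natr_sum.
(* The weights c_i/2 add up to k/2 = m+1, which turns m! into (m+1)!. *)
have -> : (\sum_i (c i)./2 = m.+1)%N.
  apply/double_inj; rewrite -half_k even_halfK // -mul2n big_distrr /=.
  by apply: eq_bigr => i _; rewrite mul2n even_halfK.
by rewrite factS natrM; ring.
Qed.

(** Induction on the length of the word: [sum_perm_first] chooses a position for the first letter,
    [words_sum_rec] chooses a letter, and letter j occupies c_j positions. *)
Lemma sum_perm_gen m (w : 'I_m -> 'I_n) :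
  \sum_(p : 'S_m) \prod_i cl_gen R (w (p i))
  = words_sum (fun j => \sum_i (w i == j))%N.
Proof.
elim: m => [|m IHm] in w *.
  rewrite (eq_bigr (fun=> 1)) => [|p _]; last by rewrite big_ord0.
  rewrite sumr_const card_Sn /words_sum /words_coef.
  have -> : odd_support (fun j => \sum_(i < 0) (w i == j))%N = set0.
    by apply/setP=> j; rewrite !inE big_ord0.
  rewrite cards0 /= big1 => [|j _]; last by rewrite big_ord0.
  by rewrite big1 ?mul1r ?scale1r // => j _; rewrite big_ord0.
set c := (X in words_sum X); rewrite (sum_perm_first (fun i => cl_gen R (w i))).
pose F j := cl_gen R j * words_sum (decr c j).
have -> : words_sum c = \sum_j F j *+ c j.
  rewrite words_sum_rec // (bigD1 (w ord0)) //= /c (bigD1 ord0) //= eqxx.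
  by rewrite -addnA.
under [RHS]eq_bigr do rewrite -sumrMnr.
rewrite exchange_big; apply: eq_bigr => i _ /=.
rewrite (bigD1 (w i)) //= eqxx [X in _ + X]big1; last first.
  by move=> j; rewrite eq_sym => /negbTE->.
rewrite addr0.
rewrite mulr1n (IHm (fun l => w (lift i l))); congr (_ * _).
apply: eq_words_sum => j; rewrite /decr /c (bigD1_ord i) //= [w i == j]eq_sym.
by rewrite addKn.
Qed.

Lemma symmetric_power_productE c :
  symmetric_power_product R c = ((\sum_j c j)`!%:R)^-1 *: words_sum c.
Proof.
rewrite /symmetric_power_product /symmetric_product.
pose t := flatten [seq nseq (c j) j | j <- enum 'I_n].
have tE : flatten [seq nseq (c j) (cl_gen R j) | j <- enum 'I_n] = map (@cl_gen R n) t.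
  by rewrite map_flatten -map_comp; congr flatten; apply: eq_map => j /=; rewrite map_nseq.
have size_t : size t = (\sum_j c j)%N.
  rewrite size_flatten /shape -map_comp sumnE big_map big_enum.
  by apply: eq_bigr => j _ /=; rewrite size_nseq.
rewrite tE size_map -size_t; congr (_ *: _).
pose w (i : 'I_(size t)) := tnth (in_tuple t) i.
have count_w j : (\sum_i (w i == j) = c j)%N.
  transitivity (count_mem j t).
    by rewrite -sumn_count sumnE big_map [RHS]big_tnth; apply: eq_bigr.
  rewrite count_flatten -map_comp sumnE big_map big_enum /=.
  rewrite (bigD1 j) //= count_nseq /= eqxx mul1n big1 ?addn0 // => l /negbTE lj.
  by rewrite count_nseq /= lj.
rewrite -(eq_words_sum count_w) -sum_perm_gen.
apply: eq_bigr => p _; apply: eq_bigr => i _.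
by rewrite (nth_map (w i)) //= /w (tnth_nth (w i) _ (p i)).
Qed.

(** For |O| at most 1, e_O^2 = (-1)^|O|, and |O| has the parity of k; this is the source of the
    global sign. *)
Lemma words_sum_sqr c :
  words_sum c ^+ 2
  = ((-1) ^+ (\sum_j c j) *
     (if (#|odd_support c| <= 1)%N then words_coef c ^+ 2 else 0))%:A.
Proof.
set O := odd_support c.
rewrite /words_sum -/O; case: leqP => [O_le1|_]; last first.
  by rewrite scale0r expr0n mulr0 scale0r.
rewrite exprZn [cl_basis _ _ ^+ 2]expr2 cl_basisM scalerA.
have -> : symdiff O O = set0 by apply/setP=> i; rewrite in_symdiff addbb inE.
rewrite mulrC -signr_odd odd_sum -/O signr_odd; congr ((_ * _) *: _).
case: (posnP #|O|) => [/eqP|O_gt0]; first by rewrite cards_eq0 => /eqP->; rewrite cl_sign0 cards0.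
have /cards1P[i ->] : #|O| == 1%N by rewrite eqn_leq O_le1.
by rewrite cl_sign11 leqnn cards1.
Qed.

End SymmetricProducts.

(** * Coefficients of the generating polynomials *)

Section GeneratingPolynomials.
Variables (R : numFieldType) (n : nat).
Implicit Types (A : {set 'I_n}).

Lemma coef_prod_poly K (f : 'I_n -> nat -> R) k :
  (\prod_j \poly_(i < K) f j i)`_k
  = \sum_(nu : {ffun 'I_n -> 'I_K} | (\sum_j nu j)%N == k) \prod_j f j (nu j).
Proof.
under eq_bigr do rewrite poly_def.
rewrite bigA_distr_bigA coef_sum [RHS]big_mkcond; apply: eq_bigr => nu _ /=.
rewrite scaler_prod prodrXr coefZ coefXn eq_sym.
by case: eqP; rewrite ?mulr1 ?mulr0.
Qed.

Definition half_central (i : nat) : R := i`!%:R / (i./2)`!%:R ^+ 2.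

(* [half_central] is C(2m,m) at 2m and (2m+1) C(2m,m) at 2m+1, so the truncations
   of G and D are [parity_poly false K] and [parity_poly true K]. *)
Definition parity_poly (b : bool) K : {poly R} :=
  \poly_(i < K) (if odd i == b then half_central i else 0).

Lemma factR_neq0 i : i`!%:R != 0 :> R.
Proof. by rewrite pnatr_eq0 -lt0n fact_gt0. Qed.

(** The recursion of the central binomials, that is, (1 - 4 X^2) G' = 4 X G read on coefficients. *)
Lemma half_centralSS i : ~~ odd i ->
  i.+2%:R * half_central i.+2 = 4 * i.+1%:R * half_central i.
Proof.
move=> i_even; rewrite /half_central /= !factS !natrM.
have i2 : i.+2%:R = 2 * (i./2).+1%:R :> R.
  by rewrite -natrM; congr _%:R; lia.
rewrite i2; have := factR_neq0 i./2.
have : (i./2).+1%:R != 0 :> R by rewrite pnatr_eq0.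
by move: (i./2).+1%:R (i./2)`!%:R => x y x0 y0; field; rewrite x0 y0.
Qed.

(** Read on coefficients, this is D = X (X G)'. *)
Lemma half_centralS i : ~~ odd i -> half_central i.+1 = i.+1%:R * half_central i.
Proof.
move=> i_even; have i2 : (i.+1./2 = i./2)%N by lia.
by rewrite /half_central i2 factS natrM mulrA.
Qed.

(** The truncations satisfy the differential equations only in low degrees; this lets such an
    equation be multiplied by any polynomial. *)
Lemma coef_mul_low (p q : {poly R}) K :
  (forall i, (i < K)%N -> p`_i = 0) -> forall i, (i < K)%N -> (p * q)`_i = 0.
Proof.
move=> p0 i iK; rewrite coefM big1 // => j _; rewrite p0 ?mul0r //.
exact: leq_trans (ltn_ord j) iK.
Qed.

Lemma coef_even_ode K i : (i.+1 < K)%N ->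
  let G := parity_poly false K in
  (G^`() - 4 *: ('X^2 * G^`()) - 4 *: ('X * G))`_i = 0.
Proof.
move=> iK G; rewrite !coefB !coefZ coefXnM coefXM !coef_deriv.
case: i iK => [|i] iK /=; first by rewrite coef_poly /= if_same; ring.
(* For i = 0 the zero produced by the shift agrees with the multiplicity i. *)
have -> : (if (i.+1 < 2)%N then 0 else G`_(i.+1 - 2).+1 *+ (i.+1 - 2).+1) = G`_i *+ i.
  by case: i iK => [|i] _; rewrite ?mulr0n //= subSS subn1.
have iK' : (i < K)%N by lia.
rewrite !coef_poly iK iK' /= !eqbF_neg negbK.
case: (boolP (odd i)) => i_odd /=; first by rewrite !mul0rn !mulr0 !subr0.
rewrite -[_ *+ i.+2]mulr_natl half_centralSS // -[_ *+ i]mulr_natl -natr1; ring.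
Qed.

(** Multiplying the equation of G by n G^(n-1) gives (1 - 4 X^2) (G^n)' = 4 n X G^n; the
    coefficients of X^(i+1) are compared. *)
Lemma coef_even_pow K i : (0 < n)%N -> (i.+2 < K)%N ->
  let a := fun i => (parity_poly false K ^+ n)`_i in
  i.+2%:R * a i.+2 = 4 * (n + i)%:R * a i.
Proof.
move=> n0 iK; set G := parity_poly false K => /=.
(* The derivative of the truncation is reliable in one degree less. *)
have K1 : (i.+1 < K.-1)%N by lia.
have ode j : (j < K.-1)%N -> (G^`() - 4 *: ('X^2 * G^`()) - 4 *: ('X * G))`_j = 0.
  by move=> jK; apply: coef_even_ode; lia.
have := coef_mul_low (G ^+ n.-1 *+ n) ode K1.
have -> : (G^`() - 4 *: ('X^2 * G^`()) - 4 *: ('X * G)) * (G ^+ n.-1 *+ n) =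
  (G ^+ n)^`() - 4 *: ('X^2 * (G ^+ n)^`()) - 4 *: ('X * G ^+ n) *+ n.
  have Gn : G ^+ n = G * G ^+ n.-1 by rewrite -exprS prednK.
  by rewrite deriv_exp Gn -!mul_polyC; ring.
rewrite !coefB coefMn !coefZ coefXnM coefXM !coef_deriv.
have -> : (if (i.+1 < 2)%N then 0 else (G ^+ n)`_(i.+1 - 2).+1 *+ (i.+1 - 2).+1)
    = (G ^+ n)`_i *+ i.
  by clear; case: i => [|i]; rewrite ?mulr0n //= subSS subn1.
move/eqP; rewrite subr_eq0 subr_eq /= => /eqP H; rewrite [LHS]mulr_natl H.
by rewrite natrD; ring.
Qed.

Lemma coef_even_pow_double K s : (0 < n)%N -> (s.*2 < K)%N ->
  (parity_poly false K ^+ n)`_s.*2 = 4 ^+ s * pochhammer (n%:R / 2) s / s`!%:R.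
Proof.
move=> n0; elim: s => [|s IHs] sK.
  rewrite /pochhammer big_ord0 fact0 !mulr1 invr1.
  rewrite -horner_coef0 horner_exp horner_coef0 coef_poly sK /= /half_central.
  by rewrite !fact0 expr1n divr1 expr1n mul1r.
have sK' : (s.*2 < K)%N by lia.
have /= := coef_even_pow n0 (sK : (s.*2.+2 < K)%N).
rewrite doubleS IHs // /pochhammer big_ord_recr factS /=.
move: (\prod_(i < s) _) => P.
have s0 := factR_neq0 s; have s1 : s.+1%:R != 0 :> R by rewrite pnatr_eq0.
have -> : s.*2.+2%:R = 2 * s.+1%:R :> R by rewrite -natrM mul2n.
have -> : (n + s.*2)%:R = n%:R + 2 * s%:R :> R by rewrite natrD -mul2n natrM.
move=> H; apply: (@mulfI _ (2 * s.+1%:R)); first by rewrite mulf_neq0 // pnatr_eq0.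
rewrite H exprS natrM; move: s1; move: s`!%:R s.+1%:R s0 => x y x0 y0.
by field; rewrite x0 y0.
Qed.

Lemma coef_even_pow_odd K s : (0 < n)%N -> (s.*2.+1 < K)%N ->
  (parity_poly false K ^+ n)`_s.*2.+1 = 0.
Proof.
move=> n0; elim: s => [|s IHs] sK.
  (* The coefficient of X is the constant term of (G^n)', a multiple of G'(0) = 0. *)
  rewrite -[_`_1]mulr1n -coef_deriv deriv_exp coefMn coef0M coef_deriv coef_poly.
  by rewrite sK mul0rn mul0r mul0rn.
have sK' : (s.*2.+1 < K)%N by lia.
have /= := coef_even_pow n0 (sK : (s.*2.+3 < K)%N).
rewrite IHs // mulr0 => /eqP; rewrite mulf_eq0 pnatr_eq0 /= => /eqP //.
Qed.

(** Multiplying D = X G + X^2 G' by n G^(n-1) gives n X G^n + X^2 (G^n)', whose coefficient of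
    X^(i+1) is n + i times that of X^i in G^n. *)
Lemma coef_odd_even_pow K k : (0 < n)%N -> (k < K)%N ->
  let G := parity_poly false K in
  (parity_poly true K * G ^+ n.-1)`_k *+ n
  = if k is i.+1 then (n + i)%:R * (G ^+ n)`_i else 0.
Proof.
move=> n0 kK G; set D := parity_poly true K.
have DG i : (i < K)%N -> (D - 'X * G - 'X^2 * G^`())`_i = 0.
  move=> iK; rewrite !coefB coefXM coefXnM coef_deriv !coef_poly iK.
  case: i iK => [|[|i]] iK /=.
  - by rewrite !subr0.
  - by rewrite (ltn_trans _ iK) // half_centralS // mul1r subr0 subrr.
  rewrite subSS subSS subn0 (ltn_trans _ iK) //= negbK eqbF_neg.
  case: (boolP (odd i)) => i_odd /=; last by rewrite mul0rn !subr0.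
  rewrite half_centralS /= ?negbK // -[i.+2%:R]natr1; ring.
have := coef_mul_low (G ^+ n.-1 *+ n) DG kK.
have -> : (D - 'X * G - 'X^2 * G^`()) * (G ^+ n.-1 *+ n)
   = D * G ^+ n.-1 *+ n - 'X * G ^+ n *+ n - 'X^2 * (G ^+ n)^`().
  have Gn : G ^+ n = G * G ^+ n.-1 by rewrite -exprS prednK.
  by rewrite deriv_exp Gn; ring.
rewrite !coefB !coefMn coefXM coefXnM coef_deriv.
move/eqP; rewrite subr_eq0 subr_eq => /eqP->.
case: k kK => [|[|i]] _ /=; rewrite ?mul0rn ?addr0 //.
  by rewrite addn0 mulr_natl add0r.
by rewrite subSS subSS subn0 natrD; ring.
Qed.

Lemma prod_parity A (c : 'I_n -> nat) :
  \prod_j (if odd (c j) == (j \in A) then half_central (c j) else 0)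
  = if odd_support c == A then \prod_j half_central (c j) else 0.
Proof.
case: eqP => [<-|/eqP neqA].
  by apply: eq_bigr => j _; rewrite inE eqxx.
have [j jA] : exists j, odd (c j) != (j \in A).
  apply/existsP; apply: contraNT neqA => /existsPn eqA.
  by apply/eqP/setP=> j; rewrite inE; apply/eqP; have := eqA j; rewrite negbK.
by rewrite (bigD1 j) //= (negbTE jA) mul0r.
Qed.

(** Once the set of odd entries is fixed, the sum factors: D for each index in [A], G for the
    others. *)
Lemma sum_parity K k A :
  \sum_(nu : {ffun 'I_n -> 'I_K} | (\sum_j nu j)%N == k)
    (if odd_support (fun j => nu j) == A then \prod_j half_central (nu j) else 0)
  = (\prod_j parity_poly (j \in A) K)`_k.
Proof.
rewrite (coef_prod_poly K
  (fun j i => if odd i == (j \in A) then half_central i else 0)).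
by apply: eq_bigr => nu _; rewrite -prod_parity.
Qed.

Lemma card_le1_split (A : {set 'I_n}) (x : R) :
  (if (#|A| <= 1)%N then x else 0)
  = (if A == set0 then x else 0) + \sum_i (if A == [set i] then x else 0).
Proof.
have [->|A_neq0] := eqVneq A set0.
  rewrite cards0 big1 ?addr0 // => i _.
  by rewrite ifN // eq_sym -cards_eq0 cards1.
rewrite add0r; have [A_le1|A_gt1] := leqP #|A| 1.
  have /cards1P[i ->] : #|A| == 1%N by rewrite eqn_leq A_le1 card_gt0.
  rewrite (bigD1 i) //= eqxx big1 ?addr0 // => j ji.
  by rewrite ifN // (inj_eq set1_inj) eq_sym.
by rewrite big1 // => i _; rewrite ifN //; apply: contraTneq A_gt1 => ->; rewrite cards1.
Qed.

(** The empty odd support yields G^n, and each of the n singletons yields D G^(n-1). *)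
Lemma sum_half_central K k : (0 < n)%N -> (k < K)%N ->
  \sum_(nu : {ffun 'I_n -> 'I_K} | (\sum_j nu j)%N == k)
    (if (#|odd_support (fun j => nu j)| <= 1)%N
     then \prod_j half_central (nu j) else 0)
  = (parity_poly false K ^+ n)`_k
    + (if k is i.+1 then (n + i)%:R * (parity_poly false K ^+ n)`_i else 0).
Proof.
move=> n0 kK; under eq_bigr do rewrite card_le1_split.
rewrite big_split /= exchange_big /= sum_parity; congr (_ + _).
  rewrite (eq_bigr (fun=> parity_poly false K)) => [|j _]; last by rewrite inE.
  by rewrite prodr_const card_ord.
rewrite -coef_odd_even_pow // -[n in _ *+ n]card_ord -sumr_const.
apply: eq_big => // i _; rewrite sum_parity (bigD1 i) //= inE eqxx.
rewrite (eq_bigr (fun=> parity_poly false K)) => [|j ji]; last by rewrite inE (negbTE ji).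
by rewrite prodr_const (cardC1 i) card_ord.
Qed.

Lemma pochhammer_half s :
  pochhammer (1 / 2 : R) s = (s.*2)`!%:R / (4 ^+ s * s`!%:R).
Proof.
elim: s => [|s IHs]; first by rewrite /pochhammer big_ord0 fact0 !mul1r invr1.
have -> : pochhammer (1 / 2 : R) s.+1 = pochhammer (1 / 2) s * (1 / 2 + s%:R).
  by rewrite /pochhammer big_ord_recr.
rewrite IHs doubleS !factS !natrM exprS.
have -> : s.*2.+2%:R = 2 * s.+1%:R :> R by rewrite -natrM mul2n.
have -> : s.*2.+1%:R = 1 + 2 * s%:R :> R by rewrite -nat1r -mul2n natrM.
have : s.+1%:R != 0 :> R by rewrite pnatr_eq0.
have := factR_neq0 s; have : 4 ^+ s != 0 :> R by rewrite expf_neq0 // pnatr_eq0.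
move: (4 ^+ s) s.+1%:R s`!%:R => x y z x0 z0 y0.
by field; rewrite x0 y0 z0.
Qed.

Lemma pochhammer_gt0 (a : R) s : 0 < a -> 0 < pochhammer a s.
Proof. by move=> a0; apply: prodr_gt0 => i _; rewrite ltr_wpDr. Qed.

(** G^n has only even powers, so one of the two terms survives for each parity of k. For k = 2s+1
    the factor n + 2s = 2 (n/2 + s) completes (n/2)_s to (n/2)_(s+1). *)
Lemma sum_half_central_vietoris K k : (0 < n)%N -> (k < K)%N ->
  k./2`!%:R ^+ 2 / k`!%:R *
  \sum_(nu : {ffun 'I_n -> 'I_K} | (\sum_j nu j)%N == k)
    (if (#|odd_support (fun j => nu j)| <= 1)%N
     then \prod_j half_central (nu j) else 0)
  = (vietoris R n k)^-1.
Proof.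
move=> n0 kK; rewrite sum_half_central // /vietoris invf_div.
have [s [ks|ks]] : exists s, k = s.*2 \/ k = s.*2.+1 by exists k./2; lia.
  rewrite {}ks in kK *.
  have -> : (if s.*2 is i.+1 then (n + i)%:R * (parity_poly false K ^+ n)`_i
             else 0) = 0.
    by case: s kK => //= s sK; rewrite coef_even_pow_odd ?mulr0 //; lia.
  rewrite addr0 coef_even_pow_double // doubleK uphalf_double pochhammer_half.
  have := factR_neq0 s.*2; have := factR_neq0 s.
  have : 4 ^+ s != 0 :> R by rewrite expf_neq0 // pnatr_eq0.
  move: (4 ^+ s) s`!%:R (s.*2)`!%:R => x y z x0 y0 z0.
  by field; rewrite x0 y0 z0.
rewrite {}ks in kK *; rewrite coef_even_pow_odd // add0r coef_even_pow_double; [|lia..].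
have -> : (s.*2.+1./2 = s)%N by lia.
have -> : (uphalf s.*2.+1 = s.+1)%N by lia.
rewrite /pochhammer !big_ord_recr /= -!/(pochhammer _ _) pochhammer_half.
rewrite factS !natrM natrD.
have -> : s.*2.+1%:R = 1 + 2 * s%:R :> R by rewrite -nat1r -mul2n natrM.
have -> : s.*2%:R = 2 * s%:R :> R by rewrite -mul2n natrM.
have : 1 + 2 * s%:R != 0 :> R by rewrite -natrM nat1r pnatr_eq0.
have := factR_neq0 s.*2; have := factR_neq0 s.
have : 4 ^+ s != 0 :> R by rewrite expf_neq0 // pnatr_eq0.
move: (4 ^+ s) s`!%:R (s.*2)`!%:R => x y z x0 y0 z0 s0.
by field; rewrite x0 y0 z0 [_ * 2]mulrC s0.
Qed.
End GeneratingPolynomials.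

(** * Multinomial coefficients and the final identity *)

(** Makes the Euclidean division in [multinomial] exact. Entries are added one at a time, each
    through a binomial coefficient. *)
Lemma prod_fact_dvd (I : finType) (c : I -> nat) :
  (\prod_j (c j)`! %| (\sum_j c j)`!)%N.
Proof.
apply: (big_rec2 (fun p s => p %| s`!)%N) => // j p s _ ps.
rewrite -(bin_fact (leq_addr s (c j))) addKn dvdn_mull // dvdn_mul //.
Qed.

Lemma multinomial_natr (R : numFieldType) n (c : 'I_n -> nat) :
  (multinomial c)%:R = (\sum_j c j)`!%:R / \prod_j (c j)`!%:R :> R.
Proof.
rewrite /multinomial -natr_prod; apply: (canRL (mulfK _)).
  by rewrite pnatr_eq0 -lt0n prodn_gt0 // => j; apply: fact_gt0.
by rewrite -natrM divnK // prod_fact_dvd.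
Qed.

(** The multinomial k!/prod_j c_j! meets 1/k!^2 from the two averages and the square of
    [words_coef], whose own sign disappears. *)
Lemma multinomial_power_product_sqr (R : numFieldType) n (c : 'I_n -> nat) k :
  (\sum_j c j)%N = k ->
  (multinomial c)%:R *: symmetric_power_product R c ^+ 2
  = ((-1) ^+ k * (k./2`!%:R ^+ 2 / k`!%:R
     * (if (#|odd_support c| <= 1)%N
        then \prod_j half_central R (c j) else 0)))%:A.
Proof.
move=> ck; rewrite symmetric_power_productE exprZn words_sum_sqr !scalerA ck.
congr (_ *: _); rewrite mulrCA -!mulrA; congr (_ * _).
case: ifP => _; last by rewrite !mulr0.
have -> : \prod_j half_central R (c j)
    = (\prod_j (c j ^_ (uphalf (c j)))%:R) ^+ 2 / \prod_j (c j)`!%:R.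
  rewrite -prodrXl -prodf_div; apply: eq_bigr => j _.
  rewrite /half_central -ffact_uphalf_fact natrM.
  have := factR_neq0 R (c j); rewrite -{1}ffact_uphalf_fact natrM mulf_eq0 negb_or.
  move: (_ ^_ _)%:R (_`!)%:R => x y /andP[x0 y0]; by field; rewrite x0 y0.
rewrite multinomial_natr ck /words_coef ck !exprMn sqrr_sign mul1r.
have := factR_neq0 R k; have : \prod_j (c j)`!%:R != 0 :> R.
  by apply/prodf_neq0 => j _; apply: factR_neq0.
move: (\prod_j (c j)`!%:R) k`!%:R => x y x0 y0.
by field; rewrite x0 y0.
Qed.

Theorem theorem4p1 (R : realType) (n : nat) (hn : (1 <= n)%N) (k : nat) :
  let S : clifford R n :=
    \sum_(nu : {ffun 'I_n -> 'I_k.+1} | (\sum_j nu j)%N == k)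
      (multinomial (fun j => nu j))%:R
        *: symmetric_power_product R (fun j => nu j) ^+ 2 in
  S \is a GRing.unit /\ (vietoris R n k)%:A = (-1) ^+ k * S^-1.
Proof.
move=> S.
have v0 : vietoris R n k != 0.
  by rewrite mulf_neq0 ?invr_neq0 // gt_eqF // pochhammer_gt0 // divr_gt0 ?ltr0n.
pose f := in_alg (clifford R n).
(* [S] is the image of a nonzero scalar, so its inverse can be computed in [R]. The bound k+1 on the
   entries is the truncation degree K. *)
have SE : S = f ((-1) ^+ k / vietoris R n k).
  rewrite -(@sum_half_central_vietoris _ _ k.+1) // !mulr_sumr /f /= scaler_suml.
  by apply: eq_bigr => nu /eqP nuk; apply: multinomial_power_product_sqr.
rewrite SE; split.
  by apply: rmorph_unit; rewrite unitfE mulf_neq0 ?invr_neq0 ?signr_eq0.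
rewrite -fmorphV -(rmorph_sign f) -rmorphM invf_div invr_sign.
by rewrite mulrCA -expr2 sqrr_sign mulr1.
Qed.
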